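(* Let $\alpha\in(0,+\infty)$. For $i\in\{1,2\}$ let $\mathcal N^{(i)}\in\mathrm{CPTP}(A_iE_i:B_i)$ and $\mathcal M^{(i)}\in\mathrm{CP}(A_iE_i:B_i)$. Then $$D_{\mathrm M,\alpha}^{\mathrm{mx}}\Big(\mathcal N^{(1)}_{A_1E_1\to B_1}\otimes\mathcal N^{(2)}_{A_2E_2\to B_2}\Big\|\mathcal M^{(1)}_{A_1E_1\to B_1}\otimes\mathcal M^{(2)}_{A_2E_2\to B_2}\Big)\ \ge\ D_{\mathrm M,\alpha}^{\mathrm{mx}}\Big(\mathcal N^{(1)}_{A_1E_1\to B_1}\Big\|\mathcal M^{(1)}_{A_1E_1\to B_1}\Big)+D_{\mathrm M,\alpha}^{\mathrm{mx}}\Big(\mathcal N^{(2)}_{A_2E_2\to B_2}\Big\|\mathcal M^{(2)}_{A_2E_2\to B_2}\Big).$$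
   Context: All quantum systems have finite-dimensional Hilbert spaces. $\mathscr D(\mathcal H)$ is the set of density operators on $\mathcal H$. $\mathrm{CPTP}(AE:B)$ (resp. $\mathrm{CP}(AE:B)$) is the set of completely positive trace-preserving (resp. completely positive) linear maps from operators on $\mathcal H_A\otimes\mathcal H_E$ to operators on $\mathcal H_B$. Such a map applied to an operator also involving a reference system $R$ acts as the identity on $R$. Measured Rényi divergence: for a density operator $\rho$ and a positive semidefinite operator $\sigma$, $D_{\mathrm M,\alpha}(\rho\|\sigma)=\sup D_\alpha(P_{\rho}\|P_{\sigma})$, the supremum being over finite sets $\mathcal X$ and POVMs $(M_x)_{x\in\mathcal X}$ ($M_x\ge0$, $\sum_xM_x=I$), with $P_\rho(x)=\mathrm{tr}[M_x\rho]$, $P_\sigma(x)=\mathrm{tr}[M_x\sigma]$. Here $D_\alpha(P\|Q)=\frac1{\alpha-1}\log\sum_xP(x)^\alpha Q(x)^{1-\alpha}$ is the classical Rényi divergence for $\alpha\ne1$ (with the usual conventions: $+\infty$ if $\alpha>1$ and $P\not\ll Q$, or if $\alpha<1$ and $P,Q$ have disjoint supports). For $\alpha=1$, $D_{\mathrm M,1}=D_{\mathrm M}$ is the measured divergence, defined in the same way with the Kullback–Leibler divergence $D(P\|Q)=\sum_xP(x)\log\frac{P(x)}{Q(x)}$ ($+\infty$ if $P\not\ll Q$). Minimax channel divergence: for $\mathcal N\in\mathrm{CPTP}(AE:B)$ and $\mathcal M\in\mathrm{CP}(AE:B)$, $$D_{\mathrm M,\alpha}^{\mathrm{mx}}(\mathcal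 N_{AE\to B}\|\mathcal M_{AE\to B})=\sup_{\rho_{AR}\in\mathscr D(\mathcal H_A\otimes\mathcal H_R)}\ \inf_{\sigma_E,\omega_E\in\mathscr D(\mathcal H_E)}D_{\mathrm M,\alpha}\big(\mathcal N_{AE\to B}(\rho_{AR}\otimes\sigma_E)\big\|\mathcal M_{AE\to B}(\rho_{AR}\otimes\omega_E)\big),$$ with $R$ a reference system of arbitrary dimension (also optimized over). For the tensor-product maps the systems $A,E,B$ are $A_1A_2$, $E_1E_2$, $B_1B_2$. *)

(* Defs.v *)
From HB Require Import structures.
From mathcomp Require Import all_boot all_order all_algebra.
From mathcomp Require Import all_classical all_reals all_analysis.
From mathcomp Require Import complex.
From mathcomp Require mxtens.

Set Implicit Arguments.
Unset Strict Implicit.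
Unset Printing Implicit Defensive.

Import Order.TTheory GRing.Theory Num.Theory.
Import mxtens (tensmx, mxtens_index, mxtens_unindex).

Local Open Scope classical_set_scope.
Local Open Scope ring_scope.

(* The Hilbert space of a system of dimension n is C^n with C = R[i], and its
   operators are the n x n complex matrices.  A tensor product of systems of
   dimensions m and n has dimension m * n, the pair (i, j) of basis indices
   being encoded by mxtens_index (i, j). *)

Notation "A *t B" := (tensmx A B)
  (at level 40, left associativity, format "A  *t  B") : ring_scope.

Section Operators.
Variable R : realType.
Local Notation C := R[i].

(* In R[i], 0 <= z says that z is a nonnegative real, so that quantifying over
   all complex vectors v also makes X Hermitian. *)
Definition psd n (X : 'M[C]_n) : Prop :=
  forall v : 'cV[C]_n, 0 <= (map_mx Num.conj v^T *m X *m v) 0 0.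

Definition density n (rho : 'M[C]_n) : Prop := psd rho /\ \tr rho = 1.

Definition povm (X : finType) n (M : X -> 'M[C]_n) : Prop :=
  (forall x, psd (M x)) /\ \sum_x M x = 1%:M.

(* For positive semidefinite M x and rho, the trace is already real. *)
Definition outcome_weight (X : finType) n (M : X -> 'M[C]_n) (rho : 'M[C]_n)
    (x : X) : R :=
  complex.Re (\tr (M x *m rho)).

End Operators.

Section Divergences.
Variable R : realType.
Local Notation C := R[i].

Definition abs_cont (X : finType) (P Q : X -> R) : bool :=
  [forall x, (Q x == 0) ==> (P x == 0)].

Definition disjoint_supp (X : finType) (P Q : X -> R) : bool :=
  [forall x, (P x == 0) || (Q x == 0)].

(* The convention 0 * log (0 / q) = 0 holds since 0 * y = 0. *)
Definition kl_div (X : finType) (P Q : X -> R) : \bar R :=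
  if abs_cont P Q then (\sum_x P x * ln (P x / Q x))%:E else +oo%E.

(* The convention P(x)^alpha Q(x)^(1 - alpha) = 0 for P(x) = Q(x) = 0 and
   alpha > 1 holds since powR 0 y = 0 for every y != 0. *)
Definition renyi_div (alpha : R) (X : finType) (P Q : X -> R) : \bar R :=
  if alpha == 1 then kl_div P Q
  else if (1 < alpha) && ~~ abs_cont P Q then +oo%E
  else if (alpha < 1) && disjoint_supp P Q then +oo%E
  else ((alpha - 1)^-1 *
        ln (\sum_x powR (P x) alpha * powR (Q x) (1 - alpha)))%:E.

Definition measured_renyi_div (alpha : R) n (rho sigma : 'M[C]_n) : \bar R :=
  ereal_sup [set d | exists (X : finType) (M : X -> 'M[C]_n),
    povm M /\
    d = renyi_div alpha (outcome_weight M rho) (outcome_weight M sigma)].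

End Divergences.

Section Maps.
Variable R : realType.
Local Notation C := R[i].

(* The tensor product of linear maps, expanded on the matrix units
   delta_mx i j *t delta_mx k l. *)
Definition tensmap n1 m1 n2 m2 (Phi : {linear 'M[C]_n1 -> 'M[C]_m1})
    (Psi : {linear 'M[C]_n2 -> 'M[C]_m2}) (X : 'M[C]_(n1 * n2)) :
    'M[C]_(m1 * m2) :=
  \sum_(i < n1) \sum_(j < n1) \sum_(k < n2) \sum_(l < n2)
    X (mxtens_index (i, k)) (mxtens_index (j, l)) *:
      (Phi (delta_mx i j) *t Psi (delta_mx k l)).

Fact tensmap_is_linear n1 m1 n2 m2 (Phi : {linear 'M[C]_n1 -> 'M[C]_m1})
    (Psi : {linear 'M[C]_n2 -> 'M[C]_m2}) : linear (tensmap Phi Psi).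
Proof.
move=> a X Y; rewrite /tensmap.
do 4 (rewrite scaler_sumr -big_split /=; apply: eq_bigr => ? _).
by rewrite !mxE scalerDl scalerA.
Qed.

HB.instance Definition _ n1 m1 n2 m2 (Phi : {linear 'M[C]_n1 -> 'M[C]_m1})
    (Psi : {linear 'M[C]_n2 -> 'M[C]_m2}) :=
  GRing.isLinear.Build C 'M[C]_(n1 * n2) 'M[C]_(m1 * m2) *:%R
    (tensmap Phi Psi) (tensmap_is_linear Phi Psi).

Lemma tensmap_tens n1 m1 n2 m2 (Phi : {linear 'M[C]_n1 -> 'M[C]_m1})
    (Psi : {linear 'M[C]_n2 -> 'M[C]_m2}) X Y :
  tensmap Phi Psi (X *t Y) = Phi X *t Psi Y.
Proof.
have tensE (p q : nat) (A : 'M[C]_p) (B : 'M[C]_q) i j :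
    (A *t B) i j = A (mxtens_unindex i).1 (mxtens_unindex j).1
                   * B (mxtens_unindex i).2 (mxtens_unindex j).2.
  by rewrite mxE.
apply/matrixP => i j; rewrite tensE.
rewrite {2}(matrix_sum_delta X) {2}(matrix_sum_delta Y) !linear_sum /=.
rewrite !summxE mulr_suml; apply: eq_bigr => p _.
rewrite !linear_sum /= !summxE mulr_suml; apply: eq_bigr => q _.
rewrite mulr_sumr summxE; apply: eq_bigr => k _.
rewrite !linear_sum /= !summxE mulr_sumr; apply: eq_bigr => l _.
by rewrite !linearZ /= !mxE !mxtens.mxtens_indexK /= mulrACA.
Qed.

(* Phi (x) id_R on operators of the system extended by an r-dimensional R. *)
Definition with_ref r n m (Phi : {linear 'M[C]_n -> 'M[C]_m}) :
    {linear 'M[C]_(n * r) -> 'M[C]_(m * r)} :=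
  tensmap Phi (idfun : {linear 'M[C]_r -> 'M[C]_r}).

Definition cp n m (Phi : {linear 'M[C]_n -> 'M[C]_m}) : Prop :=
  forall r (X : 'M[C]_(n * r)), psd X -> psd (with_ref r Phi X).

Definition trace_preserving n m (Phi : {linear 'M[C]_n -> 'M[C]_m}) : Prop :=
  forall X, \tr (Phi X) = \tr X.

Definition cptp n m (Phi : {linear 'M[C]_n -> 'M[C]_m}) : Prop :=
  cp Phi /\ trace_preserving Phi.

(* Reordering A E R -> A R E of basis indices. *)
Definition AER_ARE a e r (i : 'I_(a * e * r)) : 'I_(a * r * e) :=
  let (ae, k) := mxtens_unindex i in
  let (ia, ie) := mxtens_unindex ae in
  mxtens_index (mxtens_index (ia, k), ie).

(* The operator rho_AR (x) sigma_E, with its factors listed as A, E, R. *)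
Definition joint_input a e r (rho : 'M[C]_(a * r)) (sigma : 'M[C]_e) :
    'M[C]_(a * e * r) :=
  mxsub (@AER_ARE a e r) (@AER_ARE a e r) (rho *t sigma).

Lemma joint_input_tens a e r (X : 'M[C]_a) (Y : 'M[C]_r) (Z : 'M[C]_e) :
  joint_input (X *t Y) Z = X *t Z *t Y.
Proof.
apply/matrixP => i j; case: (mxtens.mxtens_indexP i) => ie k.
case: (mxtens.mxtens_indexP j) => je l.
case: (mxtens.mxtens_indexP ie) => i1 i2.
case: (mxtens.mxtens_indexP je) => j1 j2.
rewrite /joint_input mxE /AER_ARE !mxtens.mxtens_indexK.
by rewrite !mxtens.tensmxE mulrAC.
Qed.

Definition minimax_div (alpha : R) a e b
    (N M : {linear 'M[C]_(a * e) -> 'M[C]_b}) : \bar R :=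
  ereal_sup [set d | exists (r : nat) (rho : 'M[C]_(a * r)),
    density rho /\
    d = ereal_inf [set d' | exists sigma omega : 'M[C]_e,
      [/\ density sigma, density omega &
        d' = measured_renyi_div alpha
               (with_ref r N (joint_input rho sigma))
               (with_ref r M (joint_input rho omega))]]].

(* Reordering A1 E1 A2 E2 -> A1 A2 E1 E2 of basis indices. *)
Definition AEAE_AAEE a1 e1 a2 e2 (i : 'I_((a1 * e1) * (a2 * e2))) :
    'I_((a1 * a2) * (e1 * e2)) :=
  let (ae1, ae2) := mxtens_unindex i in
  let (i1, k1) := mxtens_unindex ae1 in
  let (i2, k2) := mxtens_unindex ae2 in
  mxtens_index (mxtens_index (i1, i2), mxtens_index (k1, k2)).

(* N1 (x) N2 as a map with input systems A = A1 A2 and E = E1 E2. *)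
Definition parallel a1 e1 b1 a2 e2 b2
    (N1 : {linear 'M[C]_(a1 * e1) -> 'M[C]_b1})
    (N2 : {linear 'M[C]_(a2 * e2) -> 'M[C]_b2}) :
    {linear 'M[C]_((a1 * a2) * (e1 * e2)) -> 'M[C]_(b1 * b2)} :=
  tensmap N1 N2 \o mxsub (@AEAE_AAEE a1 e1 a2 e2) (@AEAE_AAEE a1 e1 a2 e2).

Lemma parallel_tens a1 e1 b1 a2 e2 b2
    (N1 : {linear 'M[C]_(a1 * e1) -> 'M[C]_b1})
    (N2 : {linear 'M[C]_(a2 * e2) -> 'M[C]_b2}) X1 X2 Y1 Y2 :
  parallel N1 N2 ((X1 *t X2) *t (Y1 *t Y2)) = N1 (X1 *t Y1) *t N2 (X2 *t Y2).
Proof.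
rewrite /parallel /= -tensmap_tens; congr tensmap.
apply/matrixP => i j; case: (mxtens.mxtens_indexP i) => i1 i2.
case: (mxtens.mxtens_indexP j) => j1 j2.
case: (mxtens.mxtens_indexP i1) => ? ?; case: (mxtens.mxtens_indexP i2) => ? ?.
case: (mxtens.mxtens_indexP j1) => ? ?; case: (mxtens.mxtens_indexP j2) => ? ?.
rewrite mxE /AEAE_AAEE !mxtens.mxtens_indexK !mxtens.tensmxE.
by rewrite mulrACA.
Qed.

End Maps.

(* Main.v *)
(* Fix near-optimal inputs rho_1 and rho_2 and use their product as input of the
   parallel maps.  For given sigma and omega on E1 E2, measure B1 R1 with a POVM
   T1 that is good for the marginals of sigma and omega on E1.  Conditioned on
   the outcome x, the remaining experiment is N2 (resp. M2) applied to rho_2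
   with a conditional state sigma_x (resp. omega_x) of E2, so that a POVM T2 x
   on B2 R2 that is good for the pair (sigma_x, omega_x) can be used next.  The
   outcome distributions then factor as P1(x) P2(y|x) and Q1(x) Q2(y|x), and the
   chain rule for classical Renyi divergences gives the sum of the two bounds.
   The measurement is adapted to sigma and omega, so no minimax theorem is
   needed.  The conditional state of E2 is obtained by slicing sigma with the
   functional X |-> tr (T1 x N1(rho_1 (x) X)) and has trace P1(x), even when the
   map (here M1) is not trace preserving. *)
Require Import Defs.
From HB Require Import structures.
From mathcomp Require Import all_boot all_order all_algebra.
From mathcomp Require Import all_classical all_reals all_analysis.
From mathcomp Require Import complex mxtens ring lra.

Set Implicit Arguments.
Unset Strict Implicit.
Unset Printing Implicit Defensive.

Import Order.TTheory GRing.Theory Num.Theory.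

Local Open Scope ring_scope.
Local Open Scope sesquilinear_scope.

(** * Chain rule for classical Renyi divergences *)

Section ChainRule.
Variables (R : realType) (alpha : R) (X : finType) (Y : X -> finType).
Variables (P1 Q1 : X -> R) (P2 Q2 : forall x, Y x -> R) (t1 t2 : R).

(** Laws of a two-stage experiment. The second alphabet [Y x] depends on the first outcome, as for
    an adaptively chosen measurement. Only the [P] side is normalized: the [Q] side will come from
    maps that need not preserve the trace. *)
Let P (u : {x : X & Y x}) : R := P1 (tag u) * P2 (tagged u).
Let Q (u : {x : X & Y x}) : R := Q1 (tag u) * Q2 (tagged u).

Hypothesis alpha_gt0 : 0 < alpha.
Hypotheses (P1_ge0 : forall x, 0 <= P1 x) (Q1_ge0 : forall x, 0 <= Q1 x).
Hypotheses (P2_ge0 : forall x (y : Y x), 0 <= P2 y).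
Hypotheses (Q2_ge0 : forall x (y : Y x), 0 <= Q2 y).
Hypotheses (P1_sum1 : \sum_x P1 x = 1) (P2_sum1 : forall x, \sum_y @P2 x y = 1).
Hypotheses (lt_t1 : (t1%:E < renyi_div alpha P1 Q1)%E).
Hypotheses (lt_t2 : forall x, (t2%:E < renyi_div alpha (@P2 x) (@Q2 x))%E).

Lemma sum1_neq0 (T : finType) (p : T -> R) :
  \sum_x p x = 1 -> exists x, p x != 0.
Proof.
move=> p1; apply/existsP; apply: contraTT (oner_neq0 R); rewrite -p1.
rewrite negb_exists => /forallP p0; rewrite big1 ?eqxx// => x _.
exact/eqP/negPn.
Qed.

(** Each [P2 x] has total mass one, so some [y] carries positive weight, and a zero of [P] at that
    pair must come from [P1 x]. *)
Lemma abs_cont_fst : abs_cont P Q -> abs_cont P1 Q1.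
Proof.
move=> /forallP PQ; apply/forallP => x; apply/implyP => /eqP Q1x.
have [y Py] := sum1_neq0 (P2_sum1 x).
have := PQ (Tagged Y y); rewrite /P /Q /= Q1x mul0r eqxx /= mulf_eq0.
by rewrite (negPf Py) orbF.
Qed.

Lemma abs_cont_snd x : abs_cont P Q -> P1 x != 0 -> abs_cont (@P2 x) (@Q2 x).
Proof.
move=> /forallP PQ P1x; apply/forallP => y; apply/implyP => /eqP Q2y.
have := PQ (Tagged Y y); rewrite /P /Q /= Q2y mulr0 eqxx /= mulf_eq0.
by rewrite (negPf P1x).
Qed.

(** The logarithm splits D(P||Q) into D(P1||Q1) plus the [P1]-average of the conditional
    divergences, and that average is at least [t2]. *)
Lemma kl_div_chain : alpha = 1 -> ((t1 + t2)%:E <= kl_div P Q)%E.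
Proof.
move=> a1; rewrite {1}/kl_div; case: ifPn => [PQ|_]; last by rewrite leey.
rewrite lee_fin.
move: lt_t1; rewrite /renyi_div a1 eqxx /kl_div abs_cont_fst// lte_fin.
move=> /ltW le1.
suff : \sum_x (P1 x * ln (P1 x / Q1 x) + P1 x * t2) <=
    \sum_u P u * ln (P u / Q u).
  apply: le_trans; rewrite big_split /= -mulr_suml P1_sum1 mul1r.
  by rewrite lerD2r.
rewrite -(@sig_big_dep _ _ _ X Y xpredT (fun=> xpredT)
  (fun x y => P1 x * P2 y * ln (P1 x * P2 y / (Q1 x * Q2 y))))/=.
apply: ler_sum => x _; have [->|P1x] := eqVneq (P1 x) 0.
  by rewrite !mul0r addr0 big1// => y _; rewrite !mul0r.
have PQ2 := abs_cont_snd PQ P1x.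
have Q1x : Q1 x != 0.
  by apply: contra P1x; have /forallP/(_ x)/implyP := abs_cont_fst PQ.
have le2 : t2 <= \sum_y P2 y * ln (P2 y / @Q2 x y).
  by have := lt_t2 x; rewrite /renyi_div a1 eqxx /kl_div PQ2 lte_fin => /ltW.
have -> : \sum_(y : Y x) P1 x * P2 y * ln (P1 x * P2 y / (Q1 x * Q2 y)) =
    \sum_(y : Y x) (P1 x * ln (P1 x / Q1 x) * P2 y
                  + P1 x * (P2 y * ln (P2 y / Q2 y))).
  (* Away from zeros of [P2], absolute continuity makes all four factors positive, so the logarithm
     of the product splits. *)
  apply: eq_bigr => y _; have [->|P2y] := eqVneq (P2 y) 0.
    by rewrite !(mulr0, mul0r) addr0.
  have Q2y : Q2 y != 0 by apply: contra P2y; have /forallP/(_ y)/implyP := PQ2.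
  rewrite invfM mulrACA [ln (P1 x / Q1 x * _)]lnM ?posrE ?divr_gt0 ?lt0r
    ?P1x ?P2y ?Q1x ?Q2y ?P1_ge0 ?P2_ge0 ?Q1_ge0 ?Q2_ge0//=.
  ring.
by rewrite big_split /= -!mulr_sumr P2_sum1 mulr1 lerD2l ler_wpM2l.
Qed.

Let S1 := \sum_x P1 x `^ alpha * Q1 x `^ (1 - alpha).
Let S2 x := \sum_y @P2 x y `^ alpha * @Q2 x y `^ (1 - alpha).

Lemma renyi_sum_chain :
  \sum_u P u `^ alpha * Q u `^ (1 - alpha) =
  \sum_x P1 x `^ alpha * Q1 x `^ (1 - alpha) * S2 x.
Proof.
rewrite -(@sig_big_dep _ _ _ X Y xpredT (fun=> xpredT)
  (fun x y => (P1 x * P2 y) `^ alpha * (Q1 x * Q2 y) `^ (1 - alpha)))/=.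
apply: eq_bigr => x _; rewrite mulr_sumr; apply: eq_bigr => y _.
by rewrite !powRM// mulrACA.
Qed.

Lemma renyi_sum_gt0 (T : finType) (p q : T -> R) x :
  (forall x, 0 <= p x) -> (forall x, 0 <= q x) -> p x != 0 -> q x != 0 ->
  0 < \sum_x p x `^ alpha * q x `^ (1 - alpha).
Proof.
move=> p0 q0 px qx; rewrite (bigD1 x)//= ltr_pwDl//.
  by rewrite mulr_gt0// powR_gt0// lt0r ?px ?qx ?p0 ?q0.
by rewrite sumr_ge0// => ? _; rewrite mulr_ge0 ?powR_ge0.
Qed.

(** The power sum of [P] and [Q] is the sum of the first-stage terms weighted by [S2 x]. A bound on
    [S2] uniform in [x] therefore factors out. The sign of [alpha - 1] decides whether it has to be
    a lower or an upper bound. *)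
Lemma renyi_div_chain : ((t1 + t2)%:E <= renyi_div alpha P Q)%E.
Proof.
case: (ltgtP alpha 1) => [a1|a1|a1]; last first.
- by rewrite {1}/renyi_div a1 eqxx kl_div_chain.
(* For [alpha > 1] the prefactor is positive: power sums are bounded below by
   [expR ((alpha - 1) * t)]. *)
- rewrite {1}/renyi_div a1 gt_eqF//=.
  case: ifPn => [|/negPn PQ]; first by rewrite leey.
  rewrite [alpha < 1]ltNge (ltW a1)/= lee_fin renyi_sum_chain.
  have a0 : 0 < alpha - 1 by rewrite subr_gt0.
  have PQ1 := abs_cont_fst PQ.
  have S1_gt0 : 0 < S1.
    have [x Px] := sum1_neq0 P1_sum1; apply: (@renyi_sum_gt0 _ _ _ x) => //.
    by apply: contra Px; have /forallP/(_ x)/implyP := PQ1.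
  rewrite ler_pdivlMl// mulrDr.
  have le1 : (alpha - 1) * t1 <= ln S1.
    move: lt_t1; rewrite /renyi_div gt_eqF// a1 PQ1/=.
    rewrite [alpha < 1]ltNge (ltW a1)/= lte_fin.
    by rewrite -ler_pdivlMl// => /ltW.
  apply: (@le_trans _ _ (ln (S1 * expR ((alpha - 1) * t2)))).
    by rewrite lnM ?posrE ?expR_gt0// expRK lerD2r.
  suff le2 : S1 * expR ((alpha - 1) * t2) <=
      \sum_x P1 x `^ alpha * Q1 x `^ (1 - alpha) * S2 x.
    rewrite ler_ln// posrE ?mulr_gt0 ?expR_gt0//.
    by rewrite (lt_le_trans _ le2)// mulr_gt0 ?expR_gt0.
  rewrite mulr_suml; apply: ler_sum => x _.
  (* Absolute continuity of the conditional laws is available only where [P1 x] is nonzero; the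
     other terms vanish. *)
  have [->|P1x] := eqVneq (P1 x) 0; first by rewrite powR0 ?gt_eqF// !mul0r.
  rewrite ler_wpM2l ?mulr_ge0 ?powR_ge0//.
  have PQ2 := abs_cont_snd PQ P1x.
  have S2_gt0 : 0 < S2 x.
    have [y Py] := sum1_neq0 (P2_sum1 x); apply: (@renyi_sum_gt0 _ _ _ y) => //.
    by apply: contra Py; have /forallP/(_ y)/implyP := PQ2.
  rewrite -(lnK S2_gt0) ler_expR.
  have := lt_t2 x; rewrite /renyi_div gt_eqF// a1 PQ2/=.
  rewrite [alpha < 1]ltNge (ltW a1)/= lte_fin.
  by rewrite -ler_pdivlMl// => /ltW.
(* For [alpha < 1] the prefactor is negative, so power sums are bounded above. A pair [(x, y)] in
   both supports makes them positive, which monotonicity of [ln] requires. *)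
- rewrite {1}/renyi_div a1 lt_eqF// [1 < alpha]ltNge (ltW a1)/=.
  case: ifPn => [|]; first by rewrite leey.
  rewrite negb_forall => /existsP[[x y]]; rewrite negb_or {1}/P {1}/Q /=.
  rewrite !mulf_eq0 !negb_or => /andP[/andP[P1x P2y] /andP[Q1x Q2y]].
  rewrite lee_fin renyi_sum_chain.
  have a0 : 0 < 1 - alpha by rewrite subr_gt0.
  have ltS (T : finType) (p q : T -> R) t z :
     (forall x, 0 <= p x) -> (forall x, 0 <= q x) ->
     p z != 0 -> q z != 0 -> (t%:E < renyi_div alpha p q)%E ->
     \sum_x p x `^ alpha * q x `^ (1 - alpha) <= expR ((alpha - 1) * t).
    move=> p0 q0 px qx; have S_gt0 := renyi_sum_gt0 p0 q0 px qx.
    have pq : disjoint_supp p q = false.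
      by apply/negbTE; rewrite negb_forall; apply/existsP; exists z;
        rewrite negb_or px qx.
    rewrite /renyi_div lt_eqF// a1 pq [1 < alpha]ltNge (ltW a1)/=.
    rewrite lte_fin => /ltW.
    by rewrite -{2}(lnK S_gt0) ler_expR ler_ndivlMl// subr_lt0.
  have le1 := ltS _ _ _ _ _ P1_ge0 Q1_ge0 P1x Q1x lt_t1.
  have S1_gt0 := renyi_sum_gt0 P1_ge0 Q1_ge0 P1x Q1x.
  have le2 : \sum_x P1 x `^ alpha * Q1 x `^ (1 - alpha) * S2 x <=
     S1 * expR ((alpha - 1) * t2).
    rewrite mulr_suml; apply: ler_sum => z _.
    rewrite ler_wpM2l ?mulr_ge0 ?powR_ge0//.
    (* Disjoint conditional supports give an infinite divergence, but then [S2 z] is 0 and the upper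
       bound is trivial. *)
    case: (boolP (disjoint_supp (@P2 z) (@Q2 z))) => [/forallP d|].
      rewrite /S2 big1 ?expR_ge0// => w _.
      by case/orP: (d w) => /eqP ->; rewrite powR0 ?mul0r ?mulr0// gt_eqF.
    rewrite negb_forall => /existsP[w]; rewrite negb_or => /andP[pw qw].
    exact: ltS pw qw (lt_t2 z).
  have S_gt0 : 0 < \sum_x P1 x `^ alpha * Q1 x `^ (1 - alpha) * S2 x.
    rewrite (bigD1 x)//= ltr_pwDl//.
      apply: mulr_gt0; last exact: renyi_sum_gt0 P2y Q2y.
      by rewrite mulr_gt0// powR_gt0// lt0r ?P1x ?Q1x ?P1_ge0 ?Q1_ge0.
    rewrite sumr_ge0// => ? _; rewrite !mulr_ge0 ?powR_ge0// sumr_ge0// => ? _.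
    by rewrite !mulr_ge0 ?powR_ge0.
  rewrite ler_ndivlMl ?subr_lt0// mulrDr.
  apply: (@le_trans _ _
    (ln (expR ((alpha - 1) * t1) * expR ((alpha - 1) * t2)))).
    rewrite ler_ln ?posrE ?mulr_gt0 ?expR_gt0//.
    by apply: le_trans le2 _; rewrite ler_pM2r ?expR_gt0.
  by rewrite -expRD expRK.
Qed.
End ChainRule.

(** * Positive semidefinite matrices *)

Section Psd.
Variable R : realType.
Local Notation C := R[i].

Lemma qformE n (X : 'M[C]_n) (v : 'cV[C]_n) :
  (map_mx Num.conj v^T *m X *m v) 0 0 =
  \sum_i \sum_j (v i 0)^* * X i j * v j 0.
Proof.
rewrite mxE exchange_big /=; apply: eq_bigr => j _; rewrite mxE mulr_suml.
by apply: eq_bigr => i _; rewrite !mxE.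
Qed.

Lemma psdP n (X : 'M[C]_n) :
  psd X <-> forall v : 'I_n -> C, 0 <= \sum_i \sum_j (v i)^* * X i j * v j.
Proof.
split=> [X0 v|X0 v]; last by rewrite qformE.
by have := X0 (\col_i v i); rewrite qformE;
   under eq_bigr do under eq_bigr do rewrite !mxE.
Qed.

Lemma psd_gram m n (B : 'M[C]_(m, n)) : psd (B^t* *m B).
Proof.
move=> v; rewrite mulmxA -mulmxA -map_mxM -trmx_mul mxE.
by rewrite sumr_ge0// => i _; rewrite !mxE mulrC mul_conjC_ge0.
Qed.

Lemma psd_sum n (X : finType) (F : X -> 'M[C]_n) :
  (forall x, psd (F x)) -> psd (\sum_x F x).
Proof.
move=> F0 v; rewrite mulmx_sumr mulmx_suml summxE sumr_ge0// => x _; exact: F0.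
Qed.

Lemma psd_scale n (c : C) (X : 'M[C]_n) : 0 <= c -> psd X -> psd (c *: X).
Proof. by move=> c0 X0 v; rewrite -scalemxAr -scalemxAl mxE mulr_ge0. Qed.

(** The form at [v] is the form of [X] at the push-forward of [v] along [f]. As [f] may be any index
    map, this covers blocks, reorderings and repeated indices. *)
Lemma psd_mxsub m n (f : 'I_m -> 'I_n) (X : 'M[C]_n) :
  psd X -> psd (mxsub f f X).
Proof.
move=> X0; apply/psdP => v.
have := X0 (\col_k \sum_(i | f i == k) v i); rewrite qformE; congr (0 <= _).
rewrite [RHS](partition_big f xpredT)//=; apply: eq_bigr => k _.
under eq_bigr do rewrite !mxE rmorph_sum mulr_suml mulr_suml.
rewrite exchange_big /=; apply: eq_bigr => i /eqP fi.
rewrite [RHS](partition_big f xpredT)//=; apply: eq_bigr => l _.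
by rewrite mulr_sumr; apply: eq_bigr => j /eqP fj; rewrite !mxE fi fj.
Qed.

(** Polarization: the form is real on vectors supported on [i] and [j], so [c * X i j + c^* * X j i]
    is real for every [c]; the values 1 and ['i] of [c] determine [X i j]. *)
Lemma psd_hermitian n (X : 'M[C]_n) : psd X -> X \is hermsymmx.
Proof.
move=> X0; have qR i j (a b : C) : a^* * X i i * a + a^* * X i j * b +
    (b^* * X j i * a + b^* * X j j * b) \is Num.real.
  pose f (k : 'I_2) := if k == 0 then i else j.
  have /psdP/(_ (fun k => if k == 0 then a else b)) := psd_mxsub f X0.
  by rewrite !big_ord_recl !big_ord0 !addr0 !mxE /f /= => /ger0_real.
have dR i : X i i \is Num.real.
  have := qR i i 1 0.
  by rewrite !(rmorph0, rmorph1, mul0r, mulr0, mulr1, mul1r, addr0).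
have oR i j c : c * X i j + c^* * X j i \is Num.real.
  have := qR i j 1 c; rewrite rmorph1 !mulr1 !mul1r [X i j * c]mulrC => cR.
  have -> : c * X i j + c^* * X j i =
     X i i + c * X i j + (c^* * X j i + c^* * X j j * c)
     - X i i - c * c^* * X j j by ring.
  by rewrite !rpredB// rpredM// -normCK rpredX// normr_real.
rewrite qualifE expr0 scale1r; apply/eqP/matrixP => i j; rewrite !mxE.
have /CrealP := oR i j 1; have /CrealP := oR i j 'i.
rewrite conjC1 !mul1r conjCi !rmorphD !rmorphM rmorphN /= conjCi opprK.
move=> E1 E2; apply: (@mulfI _ (2 * 'i)).
  by rewrite mulf_neq0 ?neq0Ci ?pnatr_eq0.
have -> : 2 * 'i * X i j =
  'i * (X i j + X j i) + ('i * X i j + - 'i * X j i) by ring.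
rewrite -E1 -E2; ring.
Qed.

(** Unitary diagonalization, followed by square roots of the eigenvalues. This Gram form reduces the
    positivity of traces and tensor products to sums of squares. *)
Lemma psd_sqrt n (X : 'M[C]_n) : psd X -> exists B : 'M[C]_n, X = B^t* *m B.
Proof.
move=> X0; have /psd_hermitian/hermitian_normalmx/orthomx_spectralP := X0.
set P := spectralmx X; set d := spectral_diag X => XE.
have Pu : P \is unitarymx by exact: spectral_unitarymx.
have d0 j : 0 <= d 0 j.
  (* The eigenvalue [d 0 j] is the quadratic form at the [j]-th eigenvector. *)
  have := X0 (P^t* *m delta_mx j 0); rewrite {1}XE invmx_unitary//.
  rewrite trmx_mul map_mxM /= trmxCK.
  rewrite !mulmxA !mulmxtVK// trmx_delta map_delta_mx -rowE -colE.
  by rewrite !mxE eqxx mulr1n.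
pose S := diag_mx (map_mx sqrtC d).
have SS : S^t* *m S = diag_mx d.
  rewrite /S tr_diag_mx map_diag_mx mulmx_diag; congr diag_mx.
  apply/rowP => j; rewrite !mxE /= conj_Creal ?ger0_real ?sqrtC_ge0//.
  by rewrite -expr2 sqrtCK.
exists (S *m P).
by rewrite trmx_mul map_mxM mulmxA -[_ *m S^t* *m S]mulmxA SS -invmx_unitary.
Qed.

(** With Y in Gram form, cyclicity turns the trace into a sum of quadratic forms of [X] at the
    columns of [B^t*]. *)
Lemma psd_trace_mul n (X Y : 'M[C]_n) : psd X -> psd Y -> 0 <= \tr (X *m Y).
Proof.
move=> X0 /psd_sqrt[B ->]; rewrite mulmxA mxtrace_mulC mulmxA.
rewrite /mxtrace sumr_ge0// => i _.
have := X0 (col i (B^t*)); congr (0 <= _).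
rewrite mxE [RHS]mxE; apply: eq_bigr => j _; rewrite !mxE; congr (_ * _).
by apply: eq_bigr => k _; rewrite !mxE conjCK.
Qed.

Lemma psd_trace_eq0 n (X : 'M[C]_n) : psd X -> \tr X = 0 -> X = 0.
Proof.
move=> /psd_sqrt[B ->] /eqP.
rewrite /mxtrace psumr_eq0 => [/allP B0|i _]; last first.
  by rewrite mxE sumr_ge0// => k _; rewrite !mxE mulrC mul_conjC_ge0.
suff -> : B = 0 by rewrite mulmx0.
apply/matrixP => k i; have := B0 i (mem_index_enum i).
rewrite mxE psumr_eq0 => [/allP/(_ k (mem_index_enum k))|l _]; last first.
  by rewrite !mxE mulrC mul_conjC_ge0.
by rewrite !mxE /= mulf_eq0 conjC_eq0 orbb => /eqP.
Qed.

Lemma psd_trace_ge0 n (X : 'M[C]_n) : psd X -> 0 <= \tr X.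
Proof.
move=> X0; rewrite -[X]mulmx1; apply: psd_trace_mul => //.
by have := psd_gram (1%:M : 'M[C]_n); rewrite trmx1 map_mx1 mulmx1.
Qed.

Lemma psd_tens m n (X : 'M[C]_m) (Y : 'M[C]_n) : psd X -> psd Y -> psd (X *t Y).
Proof.
move=> /psd_sqrt[A ->] /psd_sqrt[B ->].
by rewrite -tensmx_mul -map_mxT -trmx_tens; exact: psd_gram.
Qed.
End Psd.

(** * Tensor products and reorderings of the factors *)

Section Tens.
Variable R : realType.
Local Notation C := R[i].

Lemma sum_mxtens (V : nmodType) m n (F : 'I_(m * n) -> V) :
  \sum_p F p = \sum_i \sum_j F (mxtens_index (i, j)).
Proof.
rewrite pair_bigA /= (reindex (@mxtens_index m n)); last first.
  exists (@mxtens_unindex m n) => p _;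
    by rewrite (mxtens_indexK, mxtens_unindexK).
by apply: eq_bigr => -[].
Qed.

Lemma tensmx_linearl m n p q a (A A' : 'M[C]_(m, n)) (B : 'M[C]_(p, q)) :
  (a *: A + A') *t B = a *: (A *t B) + A' *t B.
Proof. by apply/matrixP => i j; rewrite !mxE mulrDl mulrA. Qed.

Lemma tensmx_linearr m n p q a (A : 'M[C]_(m, n)) (B B' : 'M[C]_(p, q)) :
  A *t (a *: B + B') = a *: (A *t B) + A *t B'.
Proof. by apply/matrixP => i j; rewrite !mxE mulrDr mulrCA. Qed.

Lemma tensmx_suml (X : finType) m n p q
    (A : X -> 'M[C]_(m, n)) (B : 'M[C]_(p, q)) :
  (\sum_x A x) *t B = \sum_x A x *t B.
Proof.
apply/matrixP => i j; rewrite mxE !summxE mulr_suml.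
by apply: eq_bigr => x _; rewrite mxE.
Qed.

Lemma tensmx_sumr (X : finType) m n p q
    (A : 'M[C]_(m, n)) (B : X -> 'M[C]_(p, q)) :
  A *t (\sum_x B x) = \sum_x A *t B x.
Proof.
apply/matrixP => i j; rewrite mxE !summxE mulr_sumr.
by apply: eq_bigr => x _; rewrite mxE.
Qed.

Lemma tensmx1 m n : (1%:M : 'M[C]_m) *t (1%:M : 'M[C]_n) = 1%:M.
Proof.
apply/matrixP => i j; case: (mxtens_indexP i) => i1 i2.
case: (mxtens_indexP j) => j1 j2; rewrite tensmxE !mxE.
rewrite (inj_eq (can_inj (@mxtens_indexK m n))) xpair_eqE.
by case: eqP; case: eqP; rewrite /= !(mulr0, mul0r, mulr1).
Qed.

Lemma mxtrace_tens m n (A : 'M[C]_m) (B : 'M[C]_n) :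
  \tr (A *t B) = \tr A * \tr B.
Proof. by rewrite /mxtrace mulr_sum; apply: eq_bigr => i _; rewrite mxE. Qed.

Lemma tens_delta m n (i k : 'I_m) (j l : 'I_n) :
  delta_mx (mxtens_index (i, j)) (mxtens_index (k, l)) =
  delta_mx i k *t delta_mx j l :> 'M[C]_(m * n).
Proof.
apply/matrixP => p q; case: (mxtens_indexP p) => i' j'.
case: (mxtens_indexP q) => k' l'; rewrite tensmxE !mxE.
rewrite !(inj_eq (can_inj (@mxtens_indexK m n))) !xpair_eqE -natrM mulnb.
by rewrite andbACA.
Qed.

(** Matrix units of the tensor product are products of matrix units, so product operators span.
    Linearity is assumed of plain functions, so that composite expressions can be compared
    directly. *)
Lemma tens_ext m n (V : lmodType C) (f g : 'M[C]_(m * n) -> V) :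
  linear f -> linear g -> (forall A B, f (A *t B) = g (A *t B)) -> f =1 g.
Proof.
move=> fl gl fg X.
pose F : {linear 'M[C]_(m * n) -> V} :=
  HB.pack f (GRing.isLinear.Build C _ _ _ f fl).
pose G : {linear 'M[C]_(m * n) -> V} :=
  HB.pack g (GRing.isLinear.Build C _ _ _ g gl).
rewrite -[f]/(F : _ -> _) -[g]/(G : _ -> _) (matrix_sum_delta X) !linear_sum.
apply: eq_bigr => p _; rewrite !linear_sum; apply: eq_bigr => q _.
rewrite !linearZ; congr (_ *: _).
case: (mxtens_indexP p) => i j; case: (mxtens_indexP q) => k l.
by rewrite tens_delta; exact: fg.
Qed.

Lemma mulmx_mxsub_bij m n (f : 'I_m -> 'I_n) (A B : 'M[C]_n) : bijective f ->
  mxsub f f A *m mxsub f f B = mxsub f f (A *m B).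
Proof.
move=> fb; apply/matrixP => i j; rewrite !mxE (reindex f)/=; last first.
  exact: onW_bij.
by apply: eq_bigr => k _; rewrite !mxE.
Qed.

Lemma mxtrace_mxsub_bij m n (f : 'I_m -> 'I_n) (A : 'M[C]_n) : bijective f ->
  \tr (mxsub f f A) = \tr A.
Proof.
move=> fb; rewrite /mxtrace [RHS](reindex f)/=; last exact: onW_bij.
by apply: eq_bigr => k _; rewrite !mxE.
Qed.

Lemma mxsub1_inj m n (f : 'I_m -> 'I_n) : injective f ->
  mxsub f f (1%:M : 'M[C]_n) = 1%:M.
Proof. by move=> fi; apply/matrixP => i j; rewrite !mxE (inj_eq fi). Qed.

(** * Reorderings of tensor factors *)

Lemma AEAE_AAEE_K a1 e1 a2 e2 :
  cancel (@AEAE_AAEE a1 e1 a2 e2) (@AEAE_AAEE a1 a2 e1 e2).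
Proof.
move=> p; case: (mxtens_indexP p) => i k.
case: (mxtens_indexP i) => i1 i2; case: (mxtens_indexP k) => k1 k2.
by rewrite /AEAE_AAEE !mxtens_indexK.
Qed.

Lemma AEAE_AAEE_bij a1 e1 a2 e2 : bijective (@AEAE_AAEE a1 e1 a2 e2).
Proof. by exists (@AEAE_AAEE a1 a2 e1 e2); exact: AEAE_AAEE_K. Qed.

(* mxsub pulls operators back along the index map, so that exchange sends
   operators of A1 A2 E1 E2 to operators of A1 E1 A2 E2. *)
Definition exchange a1 e1 a2 e2 (X : 'M[C]_((a1 * a2) * (e1 * e2))) :=
  mxsub (@AEAE_AAEE a1 e1 a2 e2) (@AEAE_AAEE a1 e1 a2 e2) X.
Arguments exchange {a1 e1 a2 e2} X.

Lemma exchange_tens a1 e1 a2 e2 (X1 : 'M[C]_a1) (X2 : 'M[C]_a2)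
    (Y1 : 'M[C]_e1) (Y2 : 'M[C]_e2) :
  exchange ((X1 *t X2) *t (Y1 *t Y2)) = (X1 *t Y1) *t (X2 *t Y2).
Proof.
apply/matrixP => i j; case: (mxtens_indexP i) => i1 i2.
case: (mxtens_indexP j) => j1 j2.
case: (mxtens_indexP i1) => ? ?; case: (mxtens_indexP i2) => ? ?.
case: (mxtens_indexP j1) => ? ?; case: (mxtens_indexP j2) => ? ?.
by rewrite mxE /AEAE_AAEE !mxtens_indexK !tensmxE mulrACA.
Qed.

(** * Joint inputs and maps extended by a reference system *)

Lemma joint_input_linearl a e r c (rho rho' : 'M[C]_(a * r)) (sigma : 'M[C]_e) :
  joint_input (c *: rho + rho') sigma =
  c *: joint_input rho sigma + joint_input rho' sigma.
Proof. by rewrite /joint_input tensmx_linearl linearP. Qed.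

Lemma joint_input_linearr a e r c (rho : 'M[C]_(a * r))
    (sigma sigma' : 'M[C]_e) :
  joint_input rho (c *: sigma + sigma') =
  c *: joint_input rho sigma + joint_input rho sigma'.
Proof. by rewrite /joint_input tensmx_linearr linearP. Qed.

Lemma AER_ARE_bij a e r : bijective (@AER_ARE a e r).
Proof.
exists (@AER_ARE a r e) => p; case: (mxtens_indexP p) => i k;
  by case: (mxtens_indexP i) => i1 i2; rewrite /AER_ARE !mxtens_indexK.
Qed.

Lemma mxtrace_joint_input a e r (rho : 'M[C]_(a * r)) (sigma : 'M[C]_e) :
  \tr (joint_input rho sigma) = \tr rho * \tr sigma.
Proof. by rewrite mxtrace_mxsub_bij ?mxtrace_tens//; exact: AER_ARE_bij. Qed.

Lemma with_ref_tens n m r (N : {linear 'M[C]_n -> 'M[C]_m}) X (Y : 'M[C]_r) :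
  with_ref r N (X *t Y) = N X *t Y.
Proof. exact: tensmap_tens. Qed.

Lemma mxtrace_with_ref n m r (N : {linear 'M[C]_n -> 'M[C]_m}) X :
  trace_preserving N -> \tr (with_ref r N X) = \tr X.
Proof.
move=> Ntp; move: X.
apply: (@tens_ext _ _ C^o (fun X => \tr (with_ref r N X)) (fun X => \tr X)).
- by move=> c X Y; rewrite !linearP.
- by move=> c X Y; rewrite !linearP.
- by move=> A B; rewrite with_ref_tens !mxtrace_tens Ntp.
Qed.

(** Both sides are linear in [rho1] and in [rho2], which may thus be taken to be products; there
    every map acts factorwise. *)
Lemma with_ref_parallel a1 e1 b1 r1 a2 e2 b2 r2
    (N1 : {linear 'M[C]_(a1 * e1) -> 'M[C]_b1})
    (N2 : {linear 'M[C]_(a2 * e2) -> 'M[C]_b2})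
    (rho1 : 'M[C]_(a1 * r1)) (rho2 : 'M[C]_(a2 * r2))
    (sigma1 : 'M[C]_e1) (sigma2 : 'M[C]_e2) :
  with_ref (r1 * r2) (parallel N1 N2)
    (joint_input (exchange (rho1 *t rho2)) (sigma1 *t sigma2)) =
  exchange (with_ref r1 N1 (joint_input rho1 sigma1) *t
            with_ref r2 N2 (joint_input rho2 sigma2)).
Proof.
move: rho1; apply: tens_ext => [c X Y|c X Y|A1 B1].
- by rewrite tensmx_linearl /exchange linearP joint_input_linearl linearP.
- by rewrite joint_input_linearl linearP tensmx_linearl /exchange linearP.
move: rho2; apply: tens_ext => [c X Y|c X Y|A2 B2].
- by rewrite tensmx_linearr /exchange linearP joint_input_linearl linearP.
- by rewrite joint_input_linearl linearP tensmx_linearr /exchange linearP.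
rewrite exchange_tens !joint_input_tens !with_ref_tens.
by rewrite parallel_tens exchange_tens.
Qed.

End Tens.
Arguments exchange {R a1 e1 a2 e2} X.

(** * Slice maps and the effects of measuring an output *)

Section Contract.
Variable R : realType.
Local Notation C := R[i].

(** The operator left on the first factor when the second is sandwiched between basis vectors [j]
    and [l]. *)
Definition tblock m n (j l : 'I_n) (X : 'M[C]_(m * n)) : 'M[C]_m :=
  mxsub (fun i => mxtens_index (i, j)) (fun i => mxtens_index (i, l)) X.

(* The slice map f (x) id, where X encodes an operator on C^m (x) C^n. *)
Definition pcontract m n (f : 'M[C]_m -> C) (X : 'M[C]_(m * n)) : 'M[C]_n :=
  \matrix_(j, l) f (tblock j l X).

Definition ptrace m n (X : 'M[C]_(m * n)) : 'M[C]_m := \sum_j tblock j j X.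

Lemma pcontract_tens m n (f : {scalar 'M[C]_m}) A (B : 'M[C]_n) :
  pcontract f (A *t B) = f A *: B.
Proof.
apply/matrixP => j l; rewrite !mxE.
have -> : tblock j l (A *t B) = B j l *: A.
  by apply/matrixP => i k; rewrite mxE tensmxE mxE mulrC.
by rewrite linearZ mulrC.
Qed.

Lemma pcontract_linear m n (f : {scalar 'M[C]_m}) c (X Y : 'M[C]_(m * n)) :
  pcontract f (c *: X + Y) = c *: pcontract f X + pcontract f Y.
Proof. by apply/matrixP => j l; rewrite !mxE /tblock !linearP. Qed.

Lemma mxtrace_pcontract m n (f : {scalar 'M[C]_m}) (X : 'M[C]_(m * n)) :
  \tr (pcontract f X) = f (ptrace X).
Proof. by rewrite linear_sum; apply: eq_bigr => j _; rewrite mxE. Qed.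

Lemma mxtrace_ptrace m n (X : 'M[C]_(m * n)) : \tr (ptrace X) = \tr X.
Proof.
rewrite /mxtrace sum_mxtens; apply: eq_bigr => i _.
by rewrite summxE; apply: eq_bigr => j _; rewrite mxE.
Qed.

Lemma psd_ptrace m n (X : 'M[C]_(m * n)) : psd X -> psd (ptrace X).
Proof. by move=> X0; apply: psd_sum => j; exact: psd_mxsub. Qed.

(** The form of the slice at [v] is [f] applied to the compression of [X] by [v] on the second
    factor. That compression is positive, since its form at [w] is the form of [X] at the product of
    [w] and [v]. *)
Lemma psd_pcontract m n (f : {scalar 'M[C]_m}) (X : 'M[C]_(m * n)) :
  (forall Y, psd Y -> 0 <= f Y) -> psd X -> psd (pcontract f X).
Proof.
move=> f0 /psdP X0; apply/psdP => v.
have -> : \sum_j \sum_l (v j)^* * pcontract f X j l * v l =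
   f (\sum_j \sum_l ((v j)^* * v l) *: tblock j l X).
  rewrite linear_sum; apply: eq_bigr => j _; rewrite linear_sum.
  by apply: eq_bigr => l _; rewrite linearZ mxE mulrAC.
apply/f0/psdP => w.
have [z zE] : exists z : 'I_(m * n) -> C,
    forall i j, z (mxtens_index (i, j)) = w i * v j.
  exists (fun p => w (mxtens_unindex p).1 * v (mxtens_unindex p).2) => i j.
  by rewrite mxtens_indexK.
have := X0 z; congr (0 <= _); rewrite sum_mxtens; apply: eq_bigr => i _.
under eq_bigr do rewrite sum_mxtens.
rewrite exchange_big /=; apply: eq_bigr => k _.
rewrite summxE mulr_sumr mulr_suml; apply: eq_bigr => j _.
rewrite summxE mulr_sumr mulr_suml; apply: eq_bigr => l _.
rewrite !mxE !zE rmorphM /=; ring.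
Qed.

(** The default [s0] serves operators of trace zero, which vanish: an outcome of weight zero still
    needs some conditional state. *)
Lemma psd_normalize n (X s0 : 'M[C]_n) : psd X -> density s0 ->
  exists s, density s /\ X = \tr X *: s.
Proof.
move=> X0 s0d; have [trX|trX] := eqVneq (\tr X) 0.
  by exists s0; split=> //; rewrite trX scale0r (psd_trace_eq0 X0 trX).
exists ((\tr X)^-1 *: X); split; last by rewrite scalerA divff ?scale1r.
split; last by rewrite linearZ /= mulVf.
by apply: psd_scale => //; rewrite invr_ge0 psd_trace_ge0.
Qed.

(** The weight of outcome [T] as a function of the environment operator, kept complex-valued so that
    it is a linear functional and can be used as a slice. *)
Definition effect a e b r (N : {linear 'M[C]_(a * e) -> 'M[C]_b})
    (rho : 'M[C]_(a * r)) (T : 'M[C]_(b * r)) (sigma : 'M[C]_e) : C :=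
  \tr (T *m with_ref r N (joint_input rho sigma)).

Fact effect_is_linear a e b r N rho T : scalar (@effect a e b r N rho T).
Proof.
move=> c X Y; rewrite /effect joint_input_linearr linearP mulmxDr -scalemxAr.
by rewrite linearP.
Qed.
HB.instance Definition _ a e b r N rho T :=
  GRing.isLinear.Build C 'M[C]_e C *%R (@effect a e b r N rho T)
    (@effect_is_linear a e b r N rho T).

Lemma effect_ge0 a e b r (N : {linear 'M[C]_(a * e) -> 'M[C]_b})
    (rho : 'M[C]_(a * r)) T sigma :
  cp N -> psd rho -> psd T -> psd sigma -> 0 <= effect N rho T sigma.
Proof.
move=> Ncp rho0 T0 s0; apply: psd_trace_mul => //.
by apply/Ncp/psd_mxsub/psd_tens.
Qed.

Lemma sum_effect a e b r (N : {linear 'M[C]_(a * e) -> 'M[C]_b})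
    (rho : 'M[C]_(a * r)) (X : finType) (T : X -> 'M[C]_(b * r)) sigma :
  trace_preserving N -> density rho -> povm T ->
  \sum_x effect N rho (T x) sigma = \tr sigma.
Proof.
move=> Ntp [_ rho1] [_ T1]; rewrite -linear_sum /= -mulmx_suml T1 mul1mx.
by rewrite mxtrace_with_ref// mxtrace_joint_input rho1 mul1r.
Qed.

(** This produces the conditional state for arbitrarily correlated [sigma]: by linearity only
    product operators matter, and on these both sides are the product of two outcome weights. *)
Lemma effect_parallel a1 e1 b1 r1 a2 e2 b2 r2
    (N1 : {linear 'M[C]_(a1 * e1) -> 'M[C]_b1})
    (N2 : {linear 'M[C]_(a2 * e2) -> 'M[C]_b2})
    (rho1 : 'M[C]_(a1 * r1)) (rho2 : 'M[C]_(a2 * r2)) T1 T2 sigma :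
  effect (parallel N1 N2) (exchange (rho1 *t rho2)) (exchange (T1 *t T2))
    sigma =
  effect N2 rho2 T2 (pcontract (effect N1 rho1 T1) sigma).
Proof.
move: sigma; apply: (@tens_ext R _ _ C^o) => [c X Y|c X Y|A B].
- by rewrite linearP.
- by rewrite pcontract_linear linearP.
rewrite pcontract_tens linearZ /= /effect with_ref_parallel /exchange.
have bij := @AEAE_AAEE_bij b1 b2 r1 r2.
by rewrite mulmx_mxsub_bij// mxtrace_mxsub_bij// tensmx_mul mxtrace_tens.
Qed.

End Contract.

(** * Superadditivity *)

Section Superadd.
Variable R : realType.
Local Notation C := R[i].
Local Notation Re := complex.Re.

(** Real bounds below [x] and [y] suffice, so no supremum has to be attained or finite. Sums with a
    term [-oo] equal [-oo], which settles those cases. *)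
Lemma lee_add_approx (x y z : \bar R) :
  (forall s t : R, (s%:E < x -> t%:E < y -> (s + t)%:E <= z)%E) ->
  (x + y <= z)%E.
Proof.
move=> H; rewrite leNgt; apply/negP.
move: x y z H => [x||] [y||] [z||] H //; rewrite ?ltxx ?lte_fin //= => zxy.
(* Lowering each term by a third of the gap leaves the sum above [z]. *)
- have := H (x - (x + y - z) / 3) (y - (x + y - z) / 3).
  rewrite !lte_fin lee_fin => H'.
  have : x - (x + y - z) / 3 + (y - (x + y - z) / 3) <= z.
    by apply: H'; lra.
  lra.
- have := H (x - 1) (y - 1); rewrite !lte_fin leNgt ltNyr => H'.
  by have // : false by apply: H'; lra.
(* An infinite term leaves its bound free: here it is chosen so that the two bounds add up to
   [z + 1]. *)
- have := H (x - 1) (z - x + 2); rewrite lte_fin lee_fin ltry => H'.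
  have : x - 1 + (z - x + 2) <= z by apply: H' => //; lra.
  lra.
- have := H (x - 1) 0; rewrite lte_fin leNgt ltNyr ltry => H'.
  by have // : false by apply: H' => //; lra.
- have := H (z - y + 2) (y - 1); rewrite lte_fin lee_fin ltry => H'.
  have : z - y + 2 + (y - 1) <= z by apply: H' => //; lra.
  lra.
- have := H 0 (y - 1); rewrite lte_fin leNgt ltNyr ltry => H'.
  by have // : false by apply: H' => //; lra.
- have := H (z + 1) 0; rewrite lee_fin !ltry => /(_ isT isT); lra.
- by have := H 0 0; rewrite leNgt ltNyr !ltry => /(_ isT isT).
Qed.

Lemma ReM_ge0 (x y : C) : 0 <= x -> 0 <= y -> Re (x * y) = Re x * Re y.
Proof.
case: x y => [a b] [c d]; rewrite !lecE /= => /andP[/eqP -> _] /andP[/eqP -> _].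
by rewrite mulr0 subr0.
Qed.

Lemma Re_ge0 (x : C) : 0 <= x -> 0 <= Re x.
Proof. by case: x => [a b]; rewrite lecE /= => /andP[]. Qed.

(** Summing over the second outcome first gives the identity for each [x], after which the sum over
    [T1] remains. *)
Lemma povm_exchange b1 r1 b2 r2 (X : finType) (Y : X -> finType)
    (T1 : X -> 'M[C]_(b1 * r1)) (T2 : forall x, Y x -> 'M[C]_(b2 * r2)) :
  povm T1 -> (forall x, povm (@T2 x)) ->
  povm (fun u : {x : X & Y x} =>
    exchange (T1 (tag u) *t T2 (tag u) (tagged u)) :
      'M[C]_((b1 * b2) * (r1 * r2))).
Proof.
move=> [T10 T11] T2p; split=> [[x y]|].
  by apply/psd_mxsub/psd_tens => //; have [] := T2p x.
rewrite -(@sig_big_dep _ _ _ X Y xpredT (fun=> xpredT)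
  (fun x y => exchange (T1 x *t T2 x y)))/=.
under eq_bigr => x _ do
  rewrite -linear_sum -tensmx_sumr (proj2 (T2p x)).
rewrite -linear_sum -tensmx_suml T11 tensmx1 /= mxsub1_inj//.
by apply: bij_inj; exact: AEAE_AAEE_bij.
Qed.

Lemma density_exchange a1 r1 a2 r2
    (rho1 : 'M[C]_(a1 * r1)) (rho2 : 'M[C]_(a2 * r2)) :
  density rho1 -> density rho2 ->
  density (exchange (rho1 *t rho2) : 'M[C]_((a1 * a2) * (r1 * r2))).
Proof.
move=> [p1 t1] [p2 t2]; split; first exact/psd_mxsub/psd_tens.
rewrite mxtrace_mxsub_bij ?mxtrace_tens ?t1 ?t2 ?mulr1//.
exact: AEAE_AAEE_bij.
Qed.

Lemma density_ptrace m n (X : 'M[C]_(m * n)) : density X -> density (ptrace X).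
Proof. by move=> [p t]; split; [exact: psd_ptrace|rewrite mxtrace_ptrace]. Qed.

(** Slicing with the trace is the partial trace over the first factor; this marginal is the default
    conditional state. *)
Lemma density_pcontract_trace m n (X : 'M[C]_(m * n)) :
  density X -> density (pcontract (@mxtrace C m) X).
Proof.
move=> [p t]; split; last first.
  by rewrite mxtrace_pcontract -t; exact: mxtrace_ptrace.
by apply: psd_pcontract => // Y; exact: psd_trace_ge0.
Qed.

(** * The bound for fixed inputs and thresholds *)

Section OneInput.
Variables (alpha : R) (a1 e1 b1 r1 a2 e2 b2 r2 : nat) (t1 t2 : R).
Variables (N1 M1 : {linear 'M[C]_(a1 * e1) -> 'M[C]_b1}).
Variables (N2 M2 : {linear 'M[C]_(a2 * e2) -> 'M[C]_b2}).
Variables (rho1 : 'M[C]_(a1 * r1)) (rho2 : 'M[C]_(a2 * r2)).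
Hypothesis alpha_gt0 : 0 < alpha.
Hypotheses (N1_cptp : cptp N1) (M1_cp : cp M1).
Hypotheses (N2_cptp : cptp N2) (M2_cp : cp M2).
Hypotheses (rho1_d : density rho1) (rho2_d : density rho2).

Lemma measured_renyi_div_gt n (rho sigma : 'M[C]_n) (t : R) :
  (t%:E < measured_renyi_div alpha rho sigma)%E ->
  exists (X : finType) (T : X -> 'M[C]_n), povm T /\
  (t%:E < renyi_div alpha (outcome_weight T rho) (outcome_weight T sigma))%E.
Proof. by move=> /ereal_sup_gt[_ [X [T [Tp ->]]]] tT; exists X, T. Qed.

Lemma measured_renyi_div_parallel (sigma omega : 'M[C]_(e1 * e2)) :
  (forall sigma1 omega1, density sigma1 -> density omega1 ->
    (t1%:E < measured_renyi_div alpha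
       (with_ref r1 N1 (joint_input rho1 sigma1))
       (with_ref r1 M1 (joint_input rho1 omega1)))%E) ->
  (forall sigma2 omega2, density sigma2 -> density omega2 ->
    (t2%:E < measured_renyi_div alpha
       (with_ref r2 N2 (joint_input rho2 sigma2))
       (with_ref r2 M2 (joint_input rho2 omega2)))%E) ->
  density sigma -> density omega ->
  ((t1 + t2)%:E <= measured_renyi_div alpha
     (with_ref (r1 * r2) (parallel N1 N2)
        (joint_input (exchange (rho1 *t rho2)) sigma))
     (with_ref (r1 * r2) (parallel M1 M2)
        (joint_input (exchange (rho1 *t rho2)) omega)))%E.
Proof.
move=> lt1 lt2 sd od.
have [X [T1 [T1p ltT1]]] :=
  measured_renyi_div_gt (lt1 _ _ (density_ptrace sd) (density_ptrace od)).
(* Unnormalized states of the second environment conditioned on outcome [x], on the [N] side and the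
   [M] side. *)
pose A x := pcontract (effect N1 rho1 (T1 x)) sigma.
pose B x := pcontract (effect M1 rho1 (T1 x)) omega.
have [N1_cp N1_tp] := N1_cptp; have [N2_cp N2_tp] := N2_cptp.
have [rho1_0 _] := rho1_d; have [rho2_0 _] := rho2_d.
have [T1_0 _] := T1p.
have A0 x : psd (A x).
  by apply: psd_pcontract (proj1 sd) => Y Y0; exact: effect_ge0.
have B0 x : psd (B x).
  by apply: psd_pcontract (proj1 od) => Y Y0; exact: effect_ge0.
have /choice[s sP] x := psd_normalize (A0 x) (density_pcontract_trace sd).
have /choice[w wP] x := psd_normalize (B0 x) (density_pcontract_trace od).
(* The outcome set may differ with [x], so it is chosen together with its POVM as a dependent
   pair. *)
have /choice[T2 T2P] x : exists T : {Y : finType & Y -> 'M[C]_(b2 * r2)},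
    povm (projT2 T) /\ (t2%:E < renyi_div alpha
      (outcome_weight (projT2 T) (with_ref r2 N2 (joint_input rho2 (s x))))
      (outcome_weight (projT2 T) (with_ref r2 M2 (joint_input rho2 (w x)))))%E.
  have [Y [T TP]] :=
    measured_renyi_div_gt (lt2 _ _ (proj1 (sP x)) (proj1 (wP x))).
  by exists (existT _ Y T).
pose T (u : {x : X & projT1 (T2 x)}) : 'M[C]_((b1 * b2) * (r1 * r2)) :=
  exchange (T1 (tag u) *t projT2 (T2 (tag u)) (tagged u)).
have Tp : povm T.
  exact: (@povm_exchange _ _ _ _ X (fun x => projT1 (T2 x))
    T1 (fun x => projT2 (T2 x))
    T1p (fun x => proj1 (T2P x))).
have T2_0 x (y : projT1 (T2 x)) : psd (projT2 (T2 x) y) by have [[]] := T2P x.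
apply: le_ereal_sup_tmp; eexists; first by exists _, T.
(* The weight at the marginal is also the trace of [A x], the factor split off when [A x] is
   normalized to [s x]. *)
pose P1 x := Re (effect N1 rho1 (T1 x) (ptrace sigma)).
pose Q1 x := Re (effect M1 rho1 (T1 x) (ptrace omega)).
pose P2 x (y : projT1 (T2 x)) := Re (effect N2 rho2 (projT2 (T2 x) y) (s x)).
pose Q2 x (y : projT1 (T2 x)) := Re (effect M2 rho2 (projT2 (T2 x) y) (w x)).
have -> : outcome_weight T (with_ref (r1 * r2) (parallel N1 N2)
        (joint_input (exchange (rho1 *t rho2)) sigma)) =
    (fun u => P1 (tag u) * P2 _ (tagged u)).
  apply/funext => -[x y]; rewrite /outcome_weight -/(effect _ _ _ _).
  rewrite effect_parallel.
  have [[s0 _] Ax] := sP x; rewrite -/(A x) Ax linearZ /= mxtrace_pcontract.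
  by rewrite ReM_ge0 ?effect_ge0//; apply: psd_ptrace; have [] := sd.
have -> : outcome_weight T (with_ref (r1 * r2) (parallel M1 M2)
        (joint_input (exchange (rho1 *t rho2)) omega)) =
    (fun u => Q1 (tag u) * Q2 _ (tagged u)).
  apply/funext => -[x y]; rewrite /outcome_weight -/(effect _ _ _ _).
  rewrite effect_parallel.
  have [[w0 _] Bx] := wP x; rewrite -/(B x) Bx linearZ /= mxtrace_pcontract.
  by rewrite ReM_ge0 ?effect_ge0//; apply: psd_ptrace; have [] := od.
apply: renyi_div_chain => //.
- by move=> x; apply/Re_ge0/effect_ge0 => //; apply: psd_ptrace; have [] := sd.
- by move=> x; apply/Re_ge0/effect_ge0 => //; apply: psd_ptrace; have [] := od.
- by move=> x y; apply/Re_ge0/effect_ge0 => //; have [[]] := sP x.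
- by move=> x y; apply/Re_ge0/effect_ge0 => //; have [[]] := wP x.
- rewrite -(raddf_sum (@complex.Re R)) sum_effect//.
  by rewrite (proj2 (density_ptrace sd)).
- move=> x; rewrite -raddf_sum /= sum_effect//; last by have [] := T2P x.
  by have [[_ ->]] := sP x.
- by move=> x; have [] := T2P x.
Qed.
End OneInput.
End Superadd.

Theorem lemma13 (R : realType) (alpha : R) (alpha_gt0 : 0 < alpha)
  (a1 e1 b1 a2 e2 b2 : nat)
  (N1 M1 : {linear 'M[R[i]]_(a1 * e1) -> 'M[R[i]]_b1})
  (N2 M2 : {linear 'M[R[i]]_(a2 * e2) -> 'M[R[i]]_b2})
  (N1_cptp : cptp N1) (M1_cp : cp M1)
  (N2_cptp : cptp N2) (M2_cp : cp M2) :
  (minimax_div alpha (parallel N1 N2) (parallel M1 M2)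
   >= minimax_div alpha N1 M1 + minimax_div alpha N2 M2)%E.
Proof.
apply: lee_add_approx => t1 t2.
move=> /ereal_sup_gt[_ [r1 [rho1 [rho1_d ->]]]] lt1.
move=> /ereal_sup_gt[_ [r2 [rho2 [rho2_d ->]]]] lt2.
apply: le_ereal_sup_tmp; eexists.
  exists (r1 * r2)%N, (exchange (rho1 *t rho2)); split; last by [].
  exact: density_exchange.
apply: le_ereal_inf_tmp => _ [sigma [omega [sd od ->]]].
(* Each threshold lies below an infimum, hence below the divergence for every pair of environment
   states. *)
apply: measured_renyi_div_parallel => // [s1 o1 s1d o1d|s2 o2 s2d o2d].
  by apply: lt_le_trans lt1 (ereal_inf_lbound _); exists s1, o1.
by apply: lt_le_trans lt2 (ereal_inf_lbound _); exists s2, o2.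
Qed.
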